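(* Let $R \in \mathbb{C}_p(z)$ be a rational function of degree at least two. If $F(R) \neq \mathbb{P}(\mathbb{C}_p)$, then the components of $F(R)$ coincide with the analytic components of $F(R)$.
   Context: $p$ is a prime, $\mathbb{C}_p$ is the completion of an algebraic closure of $\mathbb{Q}_p$, $|\cdot|$ its norm, $\mathbb{P}(\mathbb{C}_p) = \mathbb{C}_p \cup \{\infty\}$ (with the topology of the chordal distance). For $a \in \mathbb{C}_p$ and $r \in |\mathbb{C}_p^*|$, $\{|z-a|<r\}$ is an open ball and $\{|z-a|\le r\}$ a closed ball of $\mathbb{C}_p$. An open ball of $\mathbb{P}(\mathbb{C}_p)$ is an open ball of $\mathbb{C}_p$ or the complement in $\mathbb{P}(\mathbb{C}_p)$ of a closed ball of $\mathbb{C}_p$. An open affinoid is a nonempty finite intersection of open balls of $\mathbb{P}(\mathbb{C}_p)$. For $U \subset \mathbb{P}(\mathbb{C}_p)$ open and $x \in U$, the analytic component of $U$ containing $x$ is the union of all open affinoids $X \subset U$ containing $x$. The Fatou set $F(R)$ is the set of points having a neighbourhood $X$ such that $\bigcup_{n\ge 0} R^n(X)$ omits at least 3 points of $\mathbb{P}(\mathbb{C}_p)$. For $x \in F(R)$, the component of $F(R)$ containing $x$ is the union of all open affinoids $X \subset F(R)$ containing $x$ such that $\bigcup_{n \ge 0} R^n(X)$ omits at least 3 points of $\mathbb{P}(\mathbb{C}_p)$. *)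

(* Defs.v *)
From HB Require Import structures.
From mathcomp Require Import all_boot all_order all_algebra.
From mathcomp Require Import all_classical all_reals all_analysis.
From mathcomp Require Import ring lra.

Set Implicit Arguments.
Unset Strict Implicit.
Unset Printing Implicit Defensive.

Import Order.TTheory GRing.Theory Num.Theory.
Import numFieldNormedType.Exports.

Local Open Scope classical_set_scope.
Local Open Scope ring_scope.
Local Open Scope quotient_scope.

HB.mixin Record Field_isUltrametric (R : realType) K & GRing.Field K := {
  absv : K -> R ;
  absv_ge0 : forall x, 0 <= absv x ;
  absv_eq0 : forall x, (absv x == 0) = (x == 0) ;
  absvM : forall x y, absv (x * y) = absv x * absv y ;
  absv_ultra : forall x y, absv (x + y) <= Num.max (absv x) (absv y)
}.

#[short(type="ultrametricFieldType")]
HB.structure Definition UltrametricField (R : realType) :=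
  { K of GRing.Field K & Field_isUltrametric R K }.

Section UltrametricFieldMetric.
Context {R : realType} {K : ultrametricFieldType R}.
Implicit Types x y z : K.

Lemma absv0 : absv (0 : K) = 0.
Proof. by apply/eqP; rewrite absv_eq0. Qed.

Lemma absv1 : absv (1 : K) = 1.
Proof.
have /mulfI : absv (1 : K) != 0 by rewrite absv_eq0 oner_eq0.
by apply; rewrite -absvM !mulr1.
Qed.

Lemma absvN x : absv (- x) = absv x.
Proof.
suff -> : absv (- x) = absv (- 1 : K) * absv x.
  have : absv (- 1 : K) ^+ 2 == 1 by rewrite expr2 -absvM mulrNN mulr1 absv1.
  rewrite sqrf_eq1 => /orP[] /eqP e; rewrite e ?mul1r //.
  by have := absv_ge0 (- 1 : K); rewrite e ler0N1.
by rewrite -absvM mulN1r.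
Qed.

Lemma absvB x y : absv (x - y) = absv (y - x).
Proof. by rewrite -absvN opprB. Qed.

Let dist x y := absv (x - y).

Let distxx x : dist x x = 0.
Proof. by rewrite /dist subrr absv0. Qed.

Let dist_eq0 x y : dist x y = 0 -> x = y.
Proof. by move/eqP; rewrite absv_eq0 subr_eq0 => /eqP. Qed.

Let dist_triangle y x z : dist x z <= dist x y + dist y z.
Proof.
have -> : dist x z = absv ((x - y) + (y - z)) by rewrite addrA subrK.
by rewrite (le_trans (absv_ultra _ _)) // ge_max lerDl lerDr !absv_ge0.
Qed.

HB.instance Definition _ := @isMetric.Build R (UltrametricField.sort K)
  dist distxx dist_eq0 absvB dist_triangle.

End UltrametricFieldMetric.

Definition padic_abs (R : realType) (p : nat) (q : rat) : R :=
  if q == 0 then 0 else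
  p%:R ^ ((logn p `|denq q|%N)%:Z - (logn p `|numq q|%N)%:Z).

Definition is_complete (R : realType) (K : ultrametricFieldType R) : Prop :=
  forall F : set_system K, ProperFilter F -> cauchy F -> exists l : K, F --> l.

Definition is_completion (R : realType) (F K : ultrametricFieldType R)
    (j : {rmorphism F -> K}) : Prop :=
  [/\ is_complete K, (forall x : F, absv (j x) = absv x) & dense (range j)].

(* [rat] carries no ultrametric structure, so that [is_completion] is spelled
   out here for the embedding [ratr]. *)
Definition is_Qp (R : realType) (p : nat) (K : ultrametricFieldType R) : Prop :=
  [/\ is_complete K, (forall q : rat, absv (ratr q : K) = padic_abs R p q)
    & dense (range (ratr : rat -> K))].

Definition is_algebraic_closure (F L : fieldType) (i : {rmorphism F -> L}) :
  Prop := GRing.closed_field_axiom L /\ (forall x : L, algebraicOver i x).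

(* [C_p] is not constructed but characterized, up to isometric isomorphism, as
   a completion of an algebraic closure of [Q_p]; the norm is the one with
   [absv p = p^-1]. *)
Definition is_Cp (R : realType) (p : nat) (K : ultrametricFieldType R) : Prop :=
  exists (Qp Qpbar : ultrametricFieldType R)
         (i : {rmorphism Qp -> Qpbar}) (j : {rmorphism Qpbar -> K}),
    [/\ is_Qp p Qp,
        is_algebraic_closure i,
        (forall x : Qp, absv (i x) = absv x)
      & is_completion j].

(* [None] is the point at infinity. *)
Definition P1 (K : Type) : Type := option K.

Section Chordal.
Context {R : realType} {K : ultrametricFieldType R}.
Implicit Types (a b c : K) (x y z : P1 K).

Definition chordal x y : R :=
  match x, y with
  | Some a, Some b => absv (a - b) / (Num.max 1 (absv a) * Num.max 1 (absv b))
  | Some a, None | None, Some a => (Num.max 1 (absv a))^-1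
  | None, None => 0
  end.

Let ht a : R := Num.max 1 (absv a).

Let ht_gt0 a : 0 < ht a.
Proof. by rewrite lt_max ltr01. Qed.

Let ht_ge1 a : 1 <= ht a.
Proof. by rewrite le_max lexx. Qed.

Let ht_ge a : absv a <= ht a.
Proof. by rewrite le_max lexx orbT. Qed.

Let absvD a b : absv (a + b) <= absv a + absv b.
Proof.
by rewrite (le_trans (absv_ultra _ _)) // ge_max lerDl lerDr !absv_ge0.
Qed.

Let chordalxx x : chordal x x = 0.
Proof. by case: x => [a|] //=; rewrite subrr absv0 mul0r. Qed.

Let chordal_eq0 x y : chordal x y = 0 -> x = y.
Proof.
case: x y => [a|] [b|] //=; rewrite -?/(ht _) => /eqP.
- rewrite mulf_eq0 invr_eq0 mulf_eq0 !(gt_eqF (ht_gt0 _)) !orbF.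
  by rewrite absv_eq0 subr_eq0 => /eqP ->.
- by rewrite invr_eq0 (gt_eqF (ht_gt0 _)).
- by rewrite invr_eq0 (gt_eqF (ht_gt0 _)).
Qed.

Let chordal_sym x y : chordal x y = chordal y x.
Proof. by case: x y => [a|] [b|] //=; rewrite absvB [X in _ / X]mulrC. Qed.

Let ht_dist a b : ht a <= absv (a - b) + ht b.
Proof.
rewrite {1}/ht ge_max; apply/andP; split.
  by rewrite -[leLHS]add0r lerD // absv_ge0.
rewrite -{1}(subrK b a); apply: le_trans (absvD _ _) _.
by rewrite lerD2l.
Qed.

Let dist_le a b : absv (a - b) <= ht a + ht b.
Proof. by apply: le_trans (absvD _ _) _; rewrite absvN lerD. Qed.

Let dist_ht a b c :
  absv (a - c) * ht b <= absv (a - b) * ht c + absv (b - c) * ht a.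
Proof.
rewrite {1}/ht; case: (lerP 1 (absv b)) => _; last first.
  rewrite mulr1 -{1}(subrK b a) -addrA; apply: le_trans (absvD _ _) _.
  by rewrite lerD // ler_peMr // absv_ge0.
rewrite -absvM.
have -> : (a - c) * b = (a - b) * c + (b - c) * a by ring.
by apply: le_trans (absvD _ _) _; rewrite !absvM lerD // ler_wpM2l ?absv_ge0.
Qed.

Let chordal_triangle y x z : chordal x z <= chordal x y + chordal y z.
Proof.
case: x y z => [a|] [b|] [c|] //=; rewrite -?/(ht _) ?addr0 ?add0r //.
- have -> : absv (a - b) / (ht a * ht b) + absv (b - c) / (ht b * ht c) =
            (absv (a - b) * ht c + absv (b - c) * ht a) / (ht a * ht b * ht c).
    by field; rewrite !gt_eqF.
  rewrite ler_pdivlMr ?mulr_gt0 //.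
  have -> : absv (a - c) / (ht a * ht c) * (ht a * ht b * ht c) =
            absv (a - c) * ht b by field; rewrite !gt_eqF.
  exact: dist_ht.
- have -> : absv (a - b) / (ht a * ht b) + (ht b)^-1 =
            (absv (a - b) + ht a) / (ht a * ht b) by field; rewrite !gt_eqF.
  rewrite ler_pdivlMr ?mulr_gt0 // mulrA mulVf ?gt_eqF // mul1r absvB.
  exact: ht_dist.
- have -> : (ht a)^-1 + (ht c)^-1 = (ht a + ht c) / (ht a * ht c).
    by field; rewrite !gt_eqF.
  by rewrite ler_pM2r ?invr_gt0 ?mulr_gt0.
- have -> : (ht b)^-1 + absv (b - c) / (ht b * ht c) =
            (absv (b - c) + ht c) / (ht b * ht c) by field; rewrite !gt_eqF.
  rewrite ler_pdivlMr ?mulr_gt0 // mulrCA mulVf ?gt_eqF // mulr1.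
  exact: ht_dist.
- by rewrite addr_ge0 // invr_ge0 ltW.
Qed.

HB.instance Definition _ := Choice.copy (P1 K) (option K).
HB.instance Definition _ := @isMetric.Build R (P1 K)
  chordal chordalxx chordal_eq0 chordal_sym chordal_triangle.

End Chordal.

Section Affinoids.
Context {R : realType} {K : ultrametricFieldType R}.

(* The radii range over the value group [|K^*|]. *)
Definition is_open_ball (B : set K) : Prop :=
  exists a c : K, c != 0 /\ B = [set z | absv (z - a) < absv c].

Definition is_closed_ball (B : set K) : Prop :=
  exists a c : K, c != 0 /\ B = [set z | absv (z - a) <= absv c].

Definition is_open_ball_P1 (B : set (P1 K)) : Prop :=
  (exists D : set K, is_open_ball D /\ B = Some @` D) \/
  (exists D : set K, is_closed_ball D /\ B = ~` (Some @` D)).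

Definition is_open_affinoid (X : set (P1 K)) : Prop :=
  X !=set0 /\
  exists (n : nat) (B : 'I_n.+1 -> set (P1 K)),
    (forall i, is_open_ball_P1 (B i)) /\ X = \bigcap_i B i.

Definition analytic_component (U : set (P1 K)) (x : P1 K) : set (P1 K) :=
  \bigcup_(X in [set X | [/\ is_open_affinoid X, X `<=` U & X x]]) X.

End Affinoids.

Section RationalFunctions.
Context {K : fieldType}.
Implicit Types f : {fraction {poly K}}.

(* A reduced numerator and denominator; they depend on the representative
   [repr f] only through a common nonzero constant factor. *)
Definition numer f : {poly K} :=
  (repr f).1 %/ gcdp (repr f).1 (repr f).2.

Definition denom f : {poly K} :=
  (repr f).2 %/ gcdp (repr f).1 (repr f).2.

Let gcd_neq0 f : gcdp (repr f).1 (repr f).2 != 0.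
Proof. by rewrite gcdp_eq0 negb_and (denom_ratioP (repr f)) orbT. Qed.

Lemma denom_neq0 f : denom f != 0.
Proof. by rewrite dvdp_div_eq0 ?dvdp_gcdr // denom_ratioP. Qed.

Lemma coprimep_numer_denom f : coprimep (numer f) (denom f).
Proof. by rewrite coprimep_div_gcd // denom_ratioP orbT. Qed.

Lemma numer_div_denom f :
  FracField.tofrac (numer f) / FracField.tofrac (denom f) = f.
Proof.
have tofrac_neq0 (q : {poly K}) : q != 0 -> FracField.tofrac q != 0.
  by rewrite tofrac_eq0.
have reprE : f * FracField.tofrac (repr f).2 = FracField.tofrac (repr f).1.
  rewrite -{1}[f]reprK; unlock FracField.tofrac.
  rewrite -[LHS]FracField.pi_mul; apply/eqmodP => /=.
  rewrite FracField.equivfE /FracField.mulf.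
  by rewrite !numden_Ratio ?mulf_neq0 ?oner_neq0 ?denom_ratioP // !mulr1 mulrC.
apply: (mulIf (tofrac_neq0 _ (denom_neq0 f))).
rewrite mulfVK ?tofrac_neq0 ?denom_neq0 //.
apply: (mulIf (tofrac_neq0 _ (gcd_neq0 f))).
by rewrite -mulrA -!rmorphM /= !divpK ?dvdp_gcdl ?dvdp_gcdr // reprE.
Qed.

Definition ratdeg f : nat := (maxn (size (numer f)) (size (denom f))).-1.

(* At infinity, the value is [None] if [numer f] has the larger degree, and
   otherwise the quotient of the coefficients of degree [deg (denom f)]. *)
Definition rateval f (z : P1 K) : P1 K :=
  match z with
  | Some x => if root (denom f) x then None
              else Some ((numer f).[x] / (denom f).[x])
  | None => if (size (denom f) < size (numer f))%N then None
            else Some ((numer f)`_(size (denom f)).-1 / lead_coef (denom f))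
  end.

End RationalFunctions.

Section Fatou.
Context {R : realType} {K : ultrametricFieldType R}.
Implicit Types f : {fraction {poly K}}.

Definition forward_orbit f (X : set (P1 K)) : set (P1 K) :=
  \bigcup_n (iter n (rateval f) @` X).

(* [`I_3] is the set of natural numbers below 3. *)
Definition omits_three (A : set (P1 K)) : Prop := (`I_3 #<= ~` A)%card.

Definition fatou_set f : set (P1 K) :=
  [set x | exists X, nbhs x X /\ omits_three (forward_orbit f X)].

Definition fatou_component f (x : P1 K) : set (P1 K) :=
  \bigcup_(X in [set X | [/\ is_open_affinoid X, X `<=` fatou_set f, X x
                          & omits_three (forward_orbit f X)]]) X.

End Fatou.

(* Main.v *)
(** [f] is an open map, so the Fatou set is forward invariant: the orbit of every
affinoid contained in it avoids the Julia set, and it suffices that the Julia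
set is infinite as soon as it is nonempty.

Both facts come from one identity. For w in P^1, the homogeneous form whose
zeros are the preimages of w splits into n = deg f linear factors, C_p being
algebraically closed; hence, for suitable positive heights h,
  chordal(f z, w) * h(f, z) * h(w) = m_w * prod_(f b = w) chordal(z, b) * h(z)^n.
If f z is close to w, some preimage of w is close to z. If all preimages of
w = f a coincide with a, then chordal(f z, f a) = O(chordal(z, a)^n), so that a
finite backward invariant set consists of superattracting points. *)
Require Import Defs.
From mathcomp Require Import all_boot all_order all_algebra.
From mathcomp Require Import all_classical all_reals all_analysis.
From mathcomp Require Import ring lra.

Set Implicit Arguments.
Unset Strict Implicit.
Unset Printing Implicit Defensive.

Import Order.TTheory GRing.Theory Num.Theory.
Import numFieldNormedType.Exports.

Local Open Scope classical_set_scope.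
Local Open Scope ring_scope.

(** * Factorisation over algebraically closed fields; products with a small factor *)

Lemma closed_split (K : fieldType) : GRing.closed_field_axiom K ->
  forall p : {poly K},
    exists s : seq K, p = lead_coef p *: \prod_(a <- s) ('X - a%:P).
Proof.
move=> closedK p; have [n] := ubnP (size p); elim: n p => // n IHn p lt_p_n.
have [|] := PreClosedField.closed_rootP closedK p; last first.
  move=> noroot; exists [::]; rewrite big_nil.
  have [/eqP/size_poly1P[c _ ->]|sp] := eqVneq (size p) 1%N.
    by rewrite lead_coefC alg_polyC.
  by case: noroot; apply/(PreClosedField.closed_rootP closedK).
have [->|p0] := eqVneq p 0; first by exists [::]; rewrite lead_coef0 scale0r.
case=> a /factor_theorem[q def_p].
have q0 : q != 0 by apply: contraNneq p0 => q0; rewrite def_p q0 mul0r.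
have [|s def_q] := IHn q.
  by move: lt_p_n; rewrite def_p size_Mmonic ?monicXsubC // size_XsubC addn2.
exists (a :: s); rewrite def_p lead_coef_Mmonic ?monicXsubC // big_cons.
by rewrite {1}def_q scalerAl mulrC -scalerAr -scalerAl.
Qed.
(** If every factor exceeded [e], the product would exceed [e ^+ size s]. Applied to products of
    distances, this yields one nearby root or preimage. *)
Lemma prod_le_exp (R : realDomainType) (T : eqType) (s : seq T) (F : T -> R)
    (e : R) : (forall b, 0 <= F b) -> 0 <= e -> s != [::] ->
  \prod_(b <- s) F b <= e ^+ size s -> exists2 b, b \in s & F b <= e.
Proof.
move=> F0 e0; elim: s => // b [|c s] IHs _.
  by rewrite big_seq1 expr1; exists b; rewrite ?mem_head.
rewrite big_cons exprS => le_prod.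
have [Fb|Fb] := leP (F b) e; first by exists b; rewrite ?mem_head.
have [//||d ds Fd] := IHs; last by exists d; rewrite // in_cons ds orbT.
rewrite -(ler_pM2l (le_lt_trans e0 Fb)) (le_trans le_prod) //.
by rewrite ler_wpM2r ?exprn_ge0 // ltW.
Qed.

(** * Ultrametric estimates for sums, products and polynomial values *)

Section Ultrametric.
Context {R : realType} {K : ultrametricFieldType R}.
Implicit Types (x y z : K) (P : {poly K}).

Lemma absv_sum n (F : 'I_n -> K) (e : R) : 0 <= e ->
  (forall i, absv (F i) <= e) -> absv (\sum_i F i) <= e.
Proof.
move=> e0 Fe; elim/big_ind: _ => // [|x y xe ye]; first by rewrite absv0.
by rewrite (le_trans (absv_ultra _ _)) // ge_max xe.
Qed.

Lemma absv_prod (T : Type) (s : seq T) (F : T -> K) :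
  absv (\prod_(a <- s) F a) = \prod_(a <- s) absv (F a).
Proof. by apply: (big_morph absv); [exact: absvM|exact: absv1]. Qed.

Lemma absvX x n : absv (x ^+ n) = absv x ^+ n.
Proof. by elim: n => [|n IHn]; rewrite ?absv1 // !exprS absvM IHn. Qed.

Lemma absv_ultraB x y : absv (x - y) <= Num.max (absv x) (absv y).
Proof. by rewrite -[absv y]absvN absv_ultra. Qed.

Lemma horner_lipschitz P (r : R) : exists2 M : R, 0 <= M &
  forall x y, absv x <= r -> absv y <= r ->
    absv (P.[x] - P.[y]) <= M * absv (x - y).
Proof.
elim/poly_ind: P => [|P c [M M0 IHP]].
  by exists 0 => // x y _ _; rewrite !horner0 subrr absv0 mul0r.
(* Comparison with the value at 0 turns the Lipschitz bound into a bound for [P] on the disc. *)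
have [B B0 PB] : exists2 B : R, 0 <= B &
    forall x, absv x <= r -> absv P.[x] <= B.
  exists (Num.max (M * `|r|) (absv P.[0])).
    by rewrite le_max absv_ge0 orbT.
  move=> x xr; rewrite -(subrK P.[0] P.[x]) (le_trans (absv_ultra _ _)) //.
  have r0 : 0 <= r := le_trans (absv_ge0 _) xr.
  rewrite ge_max !le_max lexx orbT andbT (le_trans (IHP _ _ xr _)) ?absv0 //.
  by rewrite subr0 ler_wpM2l // ger0_norm.
exists (M * `|r| + B) => [|x y xr yr]; first by rewrite addr_ge0 ?mulr_ge0.
have r0 : 0 <= r := le_trans (absv_ge0 _) xr.
rewrite !hornerMXaddC.
have -> : P.[x] * x + c - (P.[y] * y + c) =
    (P.[x] - P.[y]) * x + P.[y] * (x - y) by ring.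
rewrite (le_trans (absv_ultra _ _)) // ge_max !absvM ger0_norm // mulrDl.
apply/andP; split.
  rewrite (@le_trans _ _ (M * r * absv (x - y))) //; last first.
    by rewrite lerDl mulr_ge0 // absv_ge0.
  by rewrite mulrAC ler_pM ?absv_ge0 ?mulr_ge0 ?absv_ge0 // IHP.
rewrite (@le_trans _ _ (B * absv (x - y))) //.
  by rewrite ler_wpM2r ?absv_ge0 // PB.
by rewrite lerDr !mulr_ge0 // absv_ge0.
Qed.

End Ultrametric.

Lemma ballE (R : realType) (K : ultrametricFieldType R) (x y : K) (e : R) :
  ball x e y = (absv (x - y) < e) :> Prop.
Proof. by rewrite ballEmdist. Qed.

(** * Algebraic closedness of the completion of an algebraically closed field *)

Section Completion.
Context {R : realType} {F K : ultrametricFieldType R} (j : {rmorphism F -> K}).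
Hypotheses (closedF : GRing.closed_field_axiom F) (compl : is_completion j).

Let approx (z : K) (e : R) : 0 < e -> exists c : F, absv (z - j c) < e.
Proof.
case: compl => _ _ densej e0.
have [||w [/interior_subset ze [c _ jc]]] := densej (ball z e)^°.
- by exists z; apply: nbhsx_ballx.
- exact: open_interior.
by exists c; rewrite -ballE jc.
Qed.

Section Root.
Variables (n : nat) (a : nat -> K).
Hypothesis n_gt0 : (0 < n)%N.

Let p : {poly K} := 'X^n - \poly_(i < n) a i.

(* A monic polynomial over [F] close to [p] splits, so that one of its roots
   is close to [x]. *)
Let newton_step (x : K) (e d : R) : 0 < e -> 0 < d -> absv p.[x] <= e ^+ n ->
  exists y, absv (y - x) <= e /\ absv p.[y] <= d ^+ n.
Proof.
wlog led : d / d <= e.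
  move=> hw e0 d0 px; have [de|/ltW ed] := leP d e; first exact: hw.
  have [y [xy py]] := hw e (lexx _) e0 e0 px; exists y; split=> //.
  by rewrite (le_trans py) // lerXn2r ?nnegrE ?(ltW e0) ?(ltW d0).
(* The disc of radius [r] contains [x] and all points within [e] of it; as [1 <= r], changing the
   coefficients by at most [d ^+ n / r ^+ n] changes [p] there by at most [d ^+ n]. *)
move=> e0 d0 px; pose r := Num.max 1 (Num.max (absv x) e).
have r1 : 1 <= r by rewrite le_max lexx.
have r0 : 0 < r := lt_le_trans ltr01 r1.
have h i : exists c : F, absv (a i - j c) < d ^+ n / r ^+ n.
  by apply: approx; rewrite divr_gt0 // exprn_gt0.
have [c ac] := choice h.
pose q : {poly F} := 'X^n - \poly_(i < n) c i.
have sq : (size (- \poly_(i < n) c i) < size ('X^n : {poly F}))%N.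
  by rewrite size_polyN size_polyXn ltnS size_poly.
have lq : lead_coef q = 1 by rewrite lead_coefDl // lead_coefXn.
have pq y : absv y <= r -> absv (p.[y] - (map_poly j q).[y]) <= d ^+ n.
  move=> yr; rewrite rmorphB /= map_polyXn !hornerD !hornerN opprD addrACA subrr.
  rewrite add0r opprK horner_poly.
  have -> : map_poly j (\poly_(i < n) c i) = \poly_(i < n) j (c i).
    apply/polyP => i; rewrite coef_map !coef_poly; case: ifP => // _.
    exact: (rmorph0 j).
  rewrite horner_poly addrC -sumrB absv_sum ?exprn_ge0 ?ltW // => i.
  rewrite -mulrBl absvM absvX absvB.
  rewrite (@le_trans _ _ (d ^+ n / r ^+ n * r ^+ n)) //; last first.
    by rewrite divfK // gt_eqF // exprn_gt0.
  rewrite ler_pM ?absv_ge0 ?exprn_ge0 ?absv_ge0 // ?(ltW (ac _)) //.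
  rewrite (@le_trans _ _ (r ^+ i)) ?lerXn2r ?nnegrE ?absv_ge0 ?(ltW r0) //.
  by rewrite ler_weXn2l // ltnW.
have xr : absv x <= r by rewrite !le_max lexx orbT.
have [s def_q] := closed_split closedF q; move: def_q; rewrite lq scale1r => def_q.
have size_s : size s = n.
  have := size_prod_XsubC s id; rewrite /= -def_q size_polyDl //.
  by rewrite size_polyXn => -[].
have qE y : (map_poly j q).[y] = \prod_(b <- s) (y - j b).
  rewrite {1}def_q map_prod_XsubC horner_prod.
  by apply: eq_bigr => b _; rewrite hornerXsubC.
(* Since [d <= e], the value of [q] at [x] is still at most [e ^+ n], and it is the product of the
   distances to the roots. *)
have [||||b bs xb] := @prod_le_exp _ _ s (fun b => absv (x - j b)) e.
- by move=> b; exact: absv_ge0.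
- exact: ltW.
- by rewrite -size_eq0 size_s -lt0n.
- rewrite -absv_prod -qE size_s -[_.[x]](subKr p.[x]).
  rewrite (le_trans (absv_ultraB _ _)) // ge_max px /= (le_trans (pq _ xr)) //.
  by rewrite lerXn2r ?nnegrE ?(ltW e0) ?(ltW d0).
exists (j b); rewrite absvB; split=> //.
have -> : p.[j b] = p.[j b] - (map_poly j q).[j b].
  rewrite horner_map def_q horner_prod (big_rem b) //= hornerXsubC subrr.
  by rewrite mul0r rmorph0 subr0.
apply: pq; rewrite -(subrK x (j b)) (le_trans (absv_ultra _ _)) // ge_max xr andbT.
by rewrite absvB (le_trans xb) // !le_max lexx !orbT.
Qed.

(** Iterating the approximation step with radii [e / 2 ^+ k] gives a Cauchy sequence, by the
    ultrametric inequality; its limit is a root because [p] is continuous. *)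
Lemma completion_root : exists x, root p x.
Proof.
have [e e1 p0e] : exists2 e : R, 1 <= e & absv p.[0] <= e ^+ n.
  exists (Num.max 1 (absv p.[0])); first by rewrite le_max lexx.
  set e := Num.max _ _; have e1 : 1 <= e by rewrite le_max lexx.
  rewrite (@le_trans _ _ e) //; first by rewrite le_max lexx orbT.
  by rewrite -{1}[e]expr1 ler_weXn2l.
pose d k : R := e / 2 ^+ k.
have d0 k : 0 < d k by rewrite divr_gt0 ?exprn_gt0 // (lt_le_trans ltr01).
have dS k : d k.+1 <= d k.
  rewrite /d exprS invfM mulrA mulrAC ler_pdivrMr // ler_peMr ?ltW ?d0 //.
  lra.
(* The bound on [p] sits inside the existential so that [choice] gives a total step function. *)
have h (xk : K * nat) : exists y, absv p.[xk.1] <= d xk.2 ^+ n ->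
    absv (y - xk.1) <= d xk.2 /\ absv p.[y] <= d xk.2.+1 ^+ n.
  case: xk => x k /=.
  have [px|] := pselect (absv p.[x] <= d k ^+ n); last by exists 0.
  by have [y hy] := newton_step (d0 k) (d0 k.+1) px; exists y.
have [g gP] := choice h.
pose u := fix u k := if k is k'.+1 then g (u k', k') else 0.
have pu k : absv p.[u k] <= d k ^+ n.
  elim: k => [|k /(gP (_, _))[]//]; by rewrite /d expr0 divr1.
have uS k : absv (u k.+1 - u k) <= d k by have [] := gP (_, _) (pu k).
have d_dec k m : d (k + m)%N <= d k.
  by elim: m => [|m IHm]; rewrite ?addn0 // addnS (le_trans (dS _)).
have uD k m : absv (u (k + m)%N - u k) <= d k.
  elim: m => [|m IHm]; first by rewrite addn0 subrr absv0 ltW.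
  rewrite addnS -(subrK (u (k + m)%N) (u _.+1)) -addrA.
  by rewrite (le_trans (absv_ultra _ _)) // ge_max IHm (le_trans (uS _)).
have d_small (eta : R) : 0 < eta -> exists k, d k < eta.
  move=> eta0; have e_gt0 : 0 < e := lt_le_trans ltr01 e1.
  have eta1 : 0 < eta / e by rewrite divr_gt0.
  have [k _ /(_ k (leqnn k))] := near_infty_natSinv_expn_lt (PosNum eta1).
  by rewrite /= div1r ltr_pdivlMr // mulrC => hk; exists k.
have [complete_K _ _] := compl.
have [|l ul] := complete_K (u @ \oo) _.
  apply: cauchy_exP => eta eta0; have [k dk] := d_small _ eta0; exists (u k).
  exists k => // m /= km; rewrite ballE absvB -(subnKC km).
  exact: le_lt_trans (uD _ _) dk.
have lu eta k0 : 0 < eta -> exists2 k, (k0 <= k)%N & absv (l - u k) < eta.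
  move=> eta0; have /ul[k1 _ hk] := nbhsx_ballx l _ eta0.
  exists (maxn k0 k1); first exact: leq_maxl.
  by rewrite -ballE; apply: hk; rewrite /= leq_maxr.
exists l; rewrite /root -absv_eq0; apply/eqP/le_anti; rewrite absv_ge0 andbT.
have [M M0 pM] := horner_lipschitz p (Num.max 1 (absv l)).
apply/ler_addgt0Pl => eta eta0; rewrite addr0.
(* [eta' <= 1] puts [u k] in the disc of the Lipschitz bound and gives [d k ^+ n <= d k];
   [eta' * (M + 1) <= eta] then bounds both [p.[l] - p.[u k]] and [p.[u k]]. *)
pose eta' := Num.min 1 (eta / (M + 1)).
have eta'0 : 0 < eta' by rewrite lt_min ltr01 divr_gt0 // ltr_wpDl.
have [k0 dk0] := d_small _ eta'0.
have [k /subnKC def_k luk] := lu _ k0 eta'0.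
have dk : d k < eta' by rewrite -def_k (le_lt_trans (d_dec _ _)).
have eta'_eta : eta' * (M + 1) <= eta.
  by rewrite -ler_pdivlMr ?ltr_wpDl // ge_min lexx orbT.
have eta'1 : eta' <= 1 by rewrite ge_min lexx.
rewrite -(subrK p.[u k] p.[l]) (le_trans (absv_ultra _ _)) // ge_max.
apply/andP; split.
  have ul1 : absv (u k) <= Num.max 1 (absv l).
    rewrite -(subKr l (u k)) (le_trans (absv_ultraB _ _)) // ge_max.
    by rewrite !le_max lexx orbT (le_trans (ltW luk)).
  have l1 : absv l <= Num.max 1 (absv l) by rewrite le_max lexx orbT.
  rewrite (le_trans (pM _ _ l1 ul1)) //.
  rewrite (le_trans _ eta'_eta) // mulrC ler_pM ?absv_ge0 // ?(ltW luk) //.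
  by rewrite lerDl.
rewrite (le_trans (pu k)) // (le_trans _ eta'_eta) //.
rewrite (@le_trans _ _ (d k)) //; last first.
  by rewrite (le_trans (ltW dk)) // ler_peMr ?lerDr // ltW.
rewrite -{2}[d k]expr1 ler_wiXn2l // ?ltW // (lt_le_trans dk) //.
Qed.

End Root.

Lemma completion_closed : GRing.closed_field_axiom K.
Proof.
move=> n a n_gt0; have [x /rootP] := completion_root a n_gt0.
by rewrite hornerD hornerN hornerXn horner_poly => /subr0_eq; exists x.
Qed.

End Completion.

(** * Chordal distance and homogeneous forms on the projective line *)

Section ProjectiveLine.
Context {R : realType} {K : ultrametricFieldType R}.
Implicit Types (x y z w : P1 K).

Lemma chordalE x y : chordal x y = mdist x y. Proof. by []. Qed.

Lemma chordal_ge0 x y : 0 <= chordal x y.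
Proof. by rewrite chordalE mdist_ge0. Qed.

Lemma chordalxx x : chordal x x = 0.
Proof. by rewrite chordalE mdistxx. Qed.

Lemma chordal_gt0 x y : (0 < chordal x y) = (x != y).
Proof. by rewrite chordalE mdist_gt0. Qed.

Lemma chordalC x y : chordal x y = chordal y x.
Proof. by rewrite chordalE metric_sym. Qed.

Lemma chordal_triangle x y z : chordal x z <= chordal x y + chordal y z.
Proof. by rewrite !chordalE metric_triangle. Qed.

Lemma nbhs_chordalP x (X : set (P1 K)) :
  nbhs x X <-> exists2 e : R, 0 < e & forall y, chordal x y < e -> X y.
Proof.
by rewrite nbhs_ballP; split=> -[e e0 xX]; exists e.
Qed.

(* The point [z] has homogeneous coordinates [X z : Y z]. *)
Definition homX z : K := if z is Some a then a else 1.
Definition homY z : K := if z is Some _ then 1 else 0.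
Definition height z : R := if z is Some a then Num.max 1 (absv a) else 1.

Lemma height_gt0 z : 0 < height z.
Proof. by case: z => [a|] //=; rewrite lt_max ltr01. Qed.

Lemma height_homX z : absv (homX z) <= height z.
Proof. by case: z => [a|] /=; rewrite ?absv1 // le_max lexx orbT. Qed.

Lemma height_homY z : absv (homY z) <= height z.
Proof. by case: z => [a|] /=; rewrite ?absv0 // absv1 le_max lexx. Qed.

(** Normalised by heights, the 2 by 2 determinant of homogeneous coordinates measures the chordal
    distance; infinity is then no special case. *)
Lemma absv_det z w :
  absv (homX z * homY w - homY z * homX w) = chordal z w * height w * height z.
Proof.
case: z w => [a|] [b|] /=.
- rewrite mulr1 mul1r -[RHS]mulrA [X in _ = _ * X]mulrC divfK //.
  by rewrite mulf_neq0 // gt_eqF // (height_gt0 (Some _)).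
- rewrite mulr0 mul1r sub0r absvN absv1 mulr1 mulVf //.
  by rewrite gt_eqF // (height_gt0 (Some _)).
- rewrite mulr1 mul0r subr0 absv1 mulr1 mulVf //.
  by rewrite gt_eqF // (height_gt0 (Some _)).
- by rewrite mulr0 mul0r subrr absv0 !mul0r.
Qed.

Lemma chordal_le1 z w : chordal z w <= 1.
Proof.
rewrite -(ler_pM2r (height_gt0 w)) -(ler_pM2r (height_gt0 z)) -absv_det mul1r.
rewrite (le_trans (absv_ultraB _ _)) // ge_max !absvM [height w * _]mulrC.
by rewrite !ler_pM ?absv_ge0 ?height_homX ?height_homY.
Qed.

(* The value at [z] of the form [sum_i P`_i X^i Y^(n-i)]. *)
Definition homeval n (P : {poly K}) z : K := if z is Some x then P.[x] else P`_n.

(** A form of degree [n] is a product of [n] linear forms, each the determinant of [z] with a zero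
    [b]; [absv_det] turns these into chordal distances. *)
Lemma homeval_split n (G : {poly K}) : GRing.closed_field_axiom K ->
  G != 0 -> (size G <= n.+1)%N ->
  exists2 m : R, 0 < m & exists2 s : seq (P1 K), size s = n &
    forall z, absv (homeval n G z) =
      m * \prod_(b <- s) chordal z b * height z ^+ n.
Proof.
move=> closedK G0 sG; have [s0 def_G] := closed_split closedK G.
have lc0 : lead_coef G != 0 by rewrite lead_coef_eq0.
have size_s0 : size G = (size s0).+1.
  by rewrite def_G size_scale // size_prod_XsubC.
have le_s0 : (size s0 <= n)%N by rewrite -ltnS -size_s0.
(* A polynomial of degree below [n] gives a form vanishing at infinity, with the missing degree as
   multiplicity. *)
pose s : seq (P1 K) := map Some s0 ++ nseq (n - size s0) None.
have size_s : size s = n by rewrite size_cat size_map size_nseq subnKC.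
exists (absv (lead_coef G) * \prod_(b <- s) height b).
  rewrite mulr_gt0 ?prodr_gt0 // => [|b _]; last exact: height_gt0.
  by rewrite lt_neqAle absv_ge0 eq_sym absv_eq0 lc0.
exists s => // z.
transitivity (absv (lead_coef G) *
    \prod_(b <- s) absv (homX z * homY b - homY z * homX b)); last first.
  rewrite -!mulrA; congr (_ * _).
  under eq_bigr do rewrite absv_det.
  rewrite !big_split /= big_const_seq count_predT size_s -Monoid.iteropE /=.
  by rewrite mulrA [X in X * _]mulrC.
rewrite -absv_prod -absvM big_cat /= big_map big_nseq.
case: z => [x|] /=.
  rewrite {1}def_G hornerZ horner_prod mulrA absvM.
  have -> : absv (iter (n - size s0) ( *%R (x * 0 - 1 * 1)) 1) = 1.
    by elim: (n - _)%N => [|k IHk] /=; rewrite ?absvM ?IHk;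
      rewrite ?mulr0 ?mul1r ?sub0r ?absvN ?absv1 ?mulr1.
  rewrite mulr1; congr (absv (_ * _)); apply: eq_bigr => b _.
  by rewrite hornerXsubC mulr1 mul1r.
(* At infinity the determinant with a finite zero is 1 and with infinity 0, so only degree exactly
   [n] gives a nonzero value. *)
under eq_bigr do rewrite mulr1 mul0r subr0.
rewrite big1_eq mul1r mulr0 mul0r subrr.
have [eq_s0|lt_s0] := eqVneq (size s0) n.
  by rewrite lead_coefE size_s0 eq_s0 subnn /= mulr1.
have {}lt_s0 : (size s0 < n)%N by rewrite ltn_neqAle lt_s0.
rewrite nth_default ?size_s0 // -[(n - _)%N]prednK ?subn_gt0 //=.
by rewrite mul0r mulr0.
Qed.

Lemma exists_notin_P1 (s : seq (P1 K)) : GRing.closed_field_axiom K ->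
  exists z, z \notin s.
Proof.
move=> closedK.
have /(PreClosedField.closed_nonrootP closedK)[x] :
    \prod_(a <- pmap id s) ('X - a%:P) != 0.
  by rewrite monic_neq0 // monic_prod_XsubC.
by rewrite root_prod_XsubC mem_pmap map_id; exists (Some x).
Qed.

End ProjectiveLine.

(** * Fibres, openness and total ramification of a rational map *)

Section RationalMap.
Context {R : realType} {K : ultrametricFieldType R}.
Hypothesis closedK : GRing.closed_field_axiom K.
Variable f : {fraction {poly K}}.
Implicit Types (x y z w : P1 K).

Let n := ratdeg f.

Let size_numer : (size (numer f) <= n.+1)%N.
Proof. by rewrite (leq_trans _ (leqSpred _)) // leq_maxl. Qed.

Let size_denom : (size (denom f) <= n.+1)%N.
Proof. by rewrite (leq_trans _ (leqSpred _)) // leq_maxr. Qed.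

Let size_max : maxn (size (numer f)) (size (denom f)) = n.+1.
Proof.
by rewrite /n /ratdeg prednK // leq_max orbC lt0n size_poly_eq0 denom_neq0.
Qed.

Lemma rateval_homeval z : rateval f z =
  if homeval n (denom f) z == 0 then None
  else Some (homeval n (numer f) z / homeval n (denom f) z).
Proof.
case: z => [x|] //=; case: ltnP => [lt_size|le_size].
  by rewrite nth_default ?eqxx // -ltnS -size_max (maxn_idPl (ltnW lt_size)).
have -> : n = (size (denom f)).-1 by rewrite /n /ratdeg (maxn_idPr le_size).
by rewrite -lead_coefE lead_coef_eq0 (negPf (denom_neq0 f)).
Qed.

Definition pair_height z : R :=
  Num.max (absv (homeval n (numer f) z)) (absv (homeval n (denom f) z)).

(** Coprimality excludes common finite zeros; at infinity, one of the two forms has a nonzero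
    coefficient of degree [n]. *)
Lemma pair_height_gt0 z : 0 < pair_height z.
Proof.
have absv_gt0 (c : K) : (0 < absv c) = (c != 0).
  by rewrite lt_neqAle absv_ge0 andbT eq_sym absv_eq0.
rewrite lt_max !absv_gt0 -negb_and; apply/negP => /andP[].
case: z => [x|] /=.
  move=> Px /eqP; apply/eqP.
  exact: coprimep_root (coprimep_numer_denom f) Px.
have coef_n (P : {poly K}) : size P = n.+1 -> P`_n != 0.
  by move=> sP; rewrite -[n]/(n.+1.-1) -sP -lead_coefE lead_coef_eq0 -size_poly_eq0 sP.
move: size_max; case: leqP => _ /coef_n /negPf -> //.
Qed.

(** Dehomogenised determinant of the pair [numer f], [denom f] with the coordinates of [w]; its form
    of degree [n] vanishes exactly on the fibre over [w]. *)
Definition fiber_poly w : {poly K} := homY w *: numer f - homX w *: denom f.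

Lemma homeval_fiber w z : homeval n (fiber_poly w) z =
  homY w * homeval n (numer f) z - homX w * homeval n (denom f) z.
Proof.
by case: z => [x|] /=; rewrite /fiber_poly ?hornerE // coefB !coefZ.
Qed.

Lemma absv_fiber w z : absv (homeval n (fiber_poly w) z) =
  chordal (rateval f z) w * pair_height z * height w.
Proof.
rewrite homeval_fiber rateval_homeval /pair_height.
set P := homeval n (numer f) z; set Q := homeval n (denom f) z.
have [Q0|Q0] := eqVneq Q 0.
  rewrite Q0 mulr0 subr0 absv0 max_l ?absv_ge0 // absvM mulrAC; congr (_ * _).
  by have := absv_det None w; rewrite /= mul0r subr0 mul1r mulr1.
have -> : Num.max (absv P) (absv Q) = height (Some (P / Q)) * absv Q.
  by rewrite /= maxr_pMl ?absv_ge0 // mul1r -absvM divfK // maxC.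
rewrite mulrA mulrAC [X in _ = X * _]mulrAC -absv_det -absvM /=; congr absv.
by rewrite mulrBl mulrAC divfK // mul1r [P * _]mulrC.
Qed.

Hypothesis n_gt0 : (0 < n)%N.

(** For finite [w], vanishing would make [numer f] a multiple of [denom f]; coprimality then forces
    both to be constant. *)
Lemma fiber_poly_neq0 w : fiber_poly w != 0.
Proof.
rewrite subr_eq0; case: w => [x|] /=; last first.
  by rewrite scale0r scale1r eq_sym denom_neq0.
rewrite scale1r; apply: contraL n_gt0 => /eqP def_P.
have := coprimep_numer_denom f; rewrite def_P => cop.
have sQ : size (denom f) = 1%N.
  apply/eqP; rewrite -coprimepp.
  by apply: coprimep_dvdr cop; rewrite -mul_polyC dvdp_mull.
rewrite -leqNgt -ltnS -size_max def_P sQ geq_max.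
by rewrite (leq_trans (size_scale_leq _ _)) ?sQ.
Qed.

(** [s] lists the fibre over [w] with multiplicity: the left side of the identity vanishes exactly
    when [rateval f z = w]. *)
Lemma fiberP w : exists2 m : R, 0 < m & exists s : seq (P1 K),
  [/\ size s = n, (forall b, b \in s -> rateval f b = w) &
    forall z, chordal (rateval f z) w * pair_height z * height w =
      m * \prod_(b <- s) chordal z b * height z ^+ n].
Proof.
have sG : (size (fiber_poly w) <= n.+1)%N.
  rewrite (leq_trans (size_polyD _ _)) // geq_max size_polyN.
  by rewrite !(leq_trans (size_scale_leq _ _)).
have [m m0 [s ss Gs]] := homeval_split closedK (fiber_poly_neq0 w) sG.
exists m => //; exists s; split=> // [b bs|z]; last by rewrite -absv_fiber.
apply/eqP/negPn/negP => fbw.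
have : 0 < chordal (rateval f b) w * pair_height b * height w.
  by rewrite !mulr_gt0 ?pair_height_gt0 ?height_gt0 // chordal_gt0.
by rewrite -absv_fiber Gs (big_rem b) //= chordalxx mul0r mulr0 mul0r ltxx.
Qed.

Lemma rateval_surj w : exists z, rateval f z = w.
Proof.
have [_ _ [[|b s] [ss sw _]]] := fiberP w; last by exists b; rewrite sw ?mem_head.
by move: n_gt0; rewrite -ss.
Qed.

Lemma exists_rateval_neq w : exists z, rateval f z != w.
Proof.
have [w' w'w] := exists_notin_P1 [:: w] closedK.
by have [z fz] := rateval_surj w'; exists z; rewrite fz -mem_seq1.
Qed.

(** For [w] close to [rateval f z], the identity makes the product of distances from [z] to the
    fibre over [w] small, hence one factor. The constant [m] depends on [w]; it is bounded below by
    evaluating at a point [u] whose image stays away from [w]. *)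
Lemma rateval_open z (e : R) : 0 < e -> exists2 d : R, 0 < d &
  forall w, chordal (rateval f z) w < d ->
    exists2 b, chordal z b < e & rateval f b = w.
Proof.
move=> e0; have [u fu] := exists_rateval_neq (rateval f z).
have [D D0 def_D] : exists2 D : R, 0 < D &
    chordal (rateval f u) (rateval f z) = D + D.
  exists (chordal (rateval f u) (rateval f z) / 2); last by rewrite -splitr.
  by rewrite divr_gt0 // chordal_gt0.
pose A := height z ^+ n * (D * pair_height u).
pose B := pair_height z * height u ^+ n.
have A0 : 0 < A by rewrite /A !mulr_gt0 ?exprn_gt0 ?height_gt0 ?pair_height_gt0.
have B0 : 0 < B by rewrite /B !mulr_gt0 ?exprn_gt0 ?height_gt0 ?pair_height_gt0.
(* The first bound keeps [w] at distance at least [D] from [rateval f u]; the second brings the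
   product below [(e / 2) ^+ n], the half leaving room for a strict inequality. *)
exists (Num.min D ((e / 2) ^+ n * A / B)).
  by rewrite lt_min D0 divr_gt0 // mulr_gt0 // exprn_gt0 // divr_gt0.
move=> w; rewrite lt_min => /andP[zw_D zw].
have [m m0 [s [size_s fs sE]]] := fiberP w.
have uw : D <= chordal (rateval f u) w.
  rewrite -(lerD2r D) -def_D (le_trans (chordal_triangle _ w _)) //.
  by rewrite lerD2l chordalC ltW.
have mu : D * pair_height u * height w <= m * height u ^+ n.
  rewrite (@le_trans _ _ (m * \prod_(b <- s) chordal u b * height u ^+ n)) //.
    by rewrite -sE !ler_wpM2r ?(ltW (height_gt0 _)) ?(ltW (pair_height_gt0 _)).
  rewrite ler_wpM2r ?exprn_ge0 ?(ltW (height_gt0 _)) // ler_piMr ?(ltW m0) //.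
  by apply: prodr_ile1 => b _; rewrite chordal_ge0 chordal_le1.
have prod_le : \prod_(b <- s) chordal z b <= (e / 2) ^+ size s.
  rewrite size_s -(ler_pM2r A0) (@le_trans _ _ (chordal (rateval f z) w * B)) //.
    rewrite -(ler_pM2r (height_gt0 w)).
    have -> : chordal (rateval f z) w * B * height w =
      chordal (rateval f z) w * pair_height z * height w * height u ^+ n.
      by rewrite /B; move: (_ ^+ n) => q; ring.
    rewrite sE; set p := \prod_(_ <- _) _.
    have p0 : 0 <= p by apply: prodr_ge0 => b _; apply: chordal_ge0.
    have -> : p * A * height w =
      p * height z ^+ n * (D * pair_height u * height w) by rewrite /A; move: (_ ^+ n) => q; ring.
    have -> : m * p * height z ^+ n * height u ^+ n =
      p * height z ^+ n * (m * height u ^+ n).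
      by move: (height z ^+ n) (height u ^+ n) => q q'; ring.
    by rewrite ler_wpM2l // mulr_ge0 // exprn_ge0 // ltW // height_gt0.
  by rewrite -ler_pdivlMr // ltW.
have [|||b bs zb] := prod_le_exp _ _ _ prod_le.
- exact: chordal_ge0.
- by rewrite divr_ge0 // ltW.
- by rewrite -size_eq0 size_s -lt0n.
exists b; last exact: fs.
by rewrite (le_lt_trans zb) // ltr_pdivrMr // ltr_pMr // ltr1n.
Qed.

Lemma chordal_prod_lbound (s : seq (P1 K)) a : a \notin s ->
  exists d c : R, [/\ 0 < d, 0 < c &
    forall z, chordal z a < d -> c <= \prod_(b <- s) chordal z b].
Proof.
elim: s => [|b s IHs]; first by exists 1, 1; split=> // z _; rewrite big_nil.
rewrite in_cons negb_or -chordal_gt0 => /andP[ab /IHs[d [c [d0 c0 dc]]]].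
exists (Num.min d (chordal a b / 2)), (chordal a b / 2 * c); split.
- by rewrite lt_min d0 divr_gt0.
- by rewrite mulr_gt0 ?divr_gt0.
move=> z; rewrite lt_min => /andP[/dc za zab]; rewrite big_cons.
rewrite ler_pM ?divr_ge0 ?(ltW ab) ?(ltW c0) //.
rewrite -(lerD2l (chordal a b / 2)) -splitr (le_trans (chordal_triangle a z b)) //.
by rewrite lerD2r chordalC ltW.
Qed.

(* Total ramification at [a]: the fibre of [f] through [a] is [n] times [a]. *)
Lemma rateval_contract a : (1 < n)%N ->
  (forall z, rateval f z = rateval f a -> z = a) ->
  exists2 d : R, 0 < d &
    forall z, chordal z a < d ->
      chordal (rateval f z) (rateval f a) <= chordal z a.
Proof.
move=> n_gt1 ram; have [m m0 [s [size_s fs sE]]] := fiberP (rateval f a).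
(* The fibre over another value [w'] avoids a neighbourhood of [a], so its identity bounds
   [pair_height z] from below near [a]. *)
have [w' w'a] := exists_notin_P1 [:: rateval f a] closedK.
have [m' m'0 [s' [_ fs' s'E]]] := fiberP w'.
have [|d [c [d0 c0 dc]]] := @chordal_prod_lbound s' a.
  by apply: contra w'a => /fs' <-; rewrite mem_head.
pose A := height (rateval f a) * m' * c; pose B := m * height w'.
have A0 : 0 < A by rewrite /A !mulr_gt0 ?height_gt0.
have B0 : 0 < B by rewrite /B !mulr_gt0 ?height_gt0.
(* The bound 1 allows replacing the exponent [n] by 2, and [A / B] absorbs one of the two factors
   [chordal z a]. *)
exists (Num.min d (Num.min 1 (A / B))).
  by rewrite !lt_min d0 ltr01 divr_gt0.
move=> z; rewrite !lt_min => /and3P[/dc za za1 zaAB].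
have prod_s : \prod_(b <- s) chordal z b = chordal z a ^+ n.
  rewrite -size_s; elim: s {size_s sE} fs => [|b s IHs] fs; first by rewrite big_nil.
  rewrite big_cons exprS (ram b) ?fs ?mem_head // IHs // => b' b's.
  by rewrite fs // in_cons b's orbT.
have hz : 0 < height z ^+ n by rewrite exprn_gt0 ?height_gt0.
have Fz : m' * c * height z ^+ n <= pair_height z * height w'.
  rewrite (@le_trans _ _ (chordal (rateval f z) w' * pair_height z * height w')) //.
    by rewrite s'E ler_wpM2r ?(ltW hz) // ler_wpM2l // ltW.
  rewrite ler_wpM2r ?(ltW (height_gt0 _)) //.
  by rewrite ler_piMl ?chordal_le1 // ltW ?pair_height_gt0.
have fza : chordal (rateval f z) (rateval f a) * A <= B * chordal z a ^+ n.
  rewrite -(ler_pM2r hz).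
  have -> : B * chordal z a ^+ n * height z ^+ n =
    chordal (rateval f z) (rateval f a) * pair_height z *
      height (rateval f a) * height w'
    by rewrite sE prod_s /B; move: (height z ^+ n) (chordal z a ^+ n) => q q'; ring.
  have -> : chordal (rateval f z) (rateval f a) * A * height z ^+ n =
    chordal (rateval f z) (rateval f a) * height (rateval f a) *
      (m' * c * height z ^+ n) by rewrite /A; move: (_ ^+ n) => q; ring.
  have -> : chordal (rateval f z) (rateval f a) * pair_height z *
      height (rateval f a) * height w' =
    chordal (rateval f z) (rateval f a) * height (rateval f a) *
      (pair_height z * height w') by ring.
  by rewrite ler_wpM2l // mulr_ge0 ?chordal_ge0 // ltW // height_gt0.
rewrite -(ler_pM2r A0) (le_trans fza) //.
have za2 : chordal z a ^+ n <= chordal z a ^+ 2.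
  by rewrite ler_wiXn2l ?chordal_ge0 // ltW.
rewrite (le_trans (ler_wpM2l (ltW B0) za2)) // expr2 mulrCA.
by rewrite ler_wpM2l ?chordal_ge0 // mulrC -ler_pdivlMr // ltW.
Qed.

End RationalMap.

(** * Forward invariance of the Fatou set and infinitude of the Julia set *)

Lemma common_radius (R : realDomainType) (T : eqType) (P : T -> R -> Prop)
    (s : seq T) :
  (forall a d d', d' <= d -> P a d -> P a d') ->
  {in s, forall a, exists2 d, 0 < d & P a d} ->
  exists2 d, 0 < d & {in s, forall a, P a d}.
Proof.
move=> decP; elim: s => [|b s IHs] Ps; first by exists 1.
have [|d d0 Pd] := IHs; first by move=> a sa; apply: Ps; rewrite in_cons sa orbT.
have [d' d'0 Pd'] := Ps _ (mem_head b s).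
exists (Num.min d d'); first by rewrite lt_min d0.
move=> a; rewrite in_cons => /predU1P[->|sa].
  by apply: decP Pd'; rewrite ge_min lexx orbT.
by apply: decP (Pd _ sa); rewrite ge_min lexx.
Qed.

Section FatouSet.
Context {R : realType} {K : ultrametricFieldType R}.
Hypothesis closedK : GRing.closed_field_axiom K.
Variable f : {fraction {poly K}}.
Implicit Types (x y z w : P1 K) (A B X : set (P1 K)).

Lemma omits_three_sub A B : A `<=` B -> omits_three B -> omits_three A.
Proof.
by move=> AB /card_le_trans; apply; apply: subset_card_le; apply: subsetC.
Qed.

Lemma uniq_omits_three (t : seq (P1 K)) A : uniq t -> (2 < size t)%N ->
  (forall z, z \in t -> ~ A z) -> omits_three A.
Proof.
case: t => // a t uniq_t size_t tA.
apply: (@card_le_trans _ _ _ (nth a (a :: t) @` `I_3)); last first.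
  apply: subset_card_le => _ [i /= i3 <-]; apply: tA; apply: mem_nth.
  exact: leq_trans i3 size_t.
rewrite (card_le_eqr (inj_card_eq _)) // => i k; rewrite !inE /= => i3 k3 /eqP.
by rewrite nth_uniq ?(leq_trans _ size_t) // => /eqP.
Qed.

Hypothesis deg_f : (1 < ratdeg f)%N.

Let deg_gt0 : (0 < ratdeg f)%N. Proof. exact: ltnW. Qed.

(** Since the map is open, the image of a neighbourhood is a neighbourhood of the image point, and
    its forward orbit lies in the original one. *)
Lemma fatou_forward z : fatou_set f z -> fatou_set f (rateval f z).
Proof.
move=> [X [/nbhs_chordalP[e e0 zX] omX]]; exists (rateval f @` X); split.
  have [d d0 fd] := rateval_open closedK deg_gt0 z e0.
  apply/nbhs_chordalP; exists d => // w /fd[b zb <-].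
  by exists b => //; apply: zX.
apply: omits_three_sub omX => _ [k _ [_ [y Xy <-] <-]].
by exists k.+1 => //; exists y => //; rewrite iterSr.
Qed.

Lemma forward_orbit_fatou X : X `<=` fatou_set f ->
  forward_orbit f X `<=` fatou_set f.
Proof.
move=> XF _ [k _ [y Xy <-]]; elim: k => [|k IHk] /=; first exact: XF.
exact: fatou_forward.
Qed.

(* Were the backward invariant Julia set finite, [f] would permute it and ramify
   totally over it: it would consist of superattracting periodic points, which
   lie in the Fatou set. *)
Lemma julia_infinite : fatou_set f <> [set: P1 K] ->
  infinite_set (~` fatou_set f).
Proof.
move=> FT /finite_seqP[s0 defJ]; apply: FT.
pose s := undup s0.
have sP z : (z \in s) <-> ~ fatou_set f z.
  by rewrite mem_undup -[~ _]/((~` fatou_set f) z) defJ.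
have s_back z : rateval f z \in s -> z \in s.
  by move=> /sP Jfz; apply/sP => /fatou_forward.
(* A section [g] of the map sends [s] injectively into itself by backward invariance, hence permutes
   it; so the map sends [s] to [s]. *)
have [g gP] := choice (rateval_surj closedK deg_gt0).
have g_inj : injective g by apply: can_inj gP.
have /uniq_min_size : uniq (map g s) by rewrite map_inj_uniq // undup_uniq.
move=> /(_ s) [_ /mapP[b sb ->]||_ s_perm].
- by apply: s_back; rewrite gP.
- by rewrite size_map.
have s_fwd a : a \in s -> rateval f a \in s.
  by rewrite -s_perm => /mapP[b sb ->]; rewrite gP.
(* The fibre over [rateval f a] lies in [s], where every point is some [g b] and so is determined by
   its image. *)
have s_ram a z : a \in s -> rateval f z = rateval f a -> z = a.
  move=> sa fza; have sz : z \in s by apply: s_back; rewrite fza s_fwd.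
  move: sa sz fza; rewrite -!s_perm => /mapP[b _ ->] /mapP[c _ ->].
  by rewrite !gP => ->.
apply/seteqP; split=> // a _; apply: contrapT => /sP sa.
have [e1 e1s] := exists_notin_P1 s closedK.
have [e2] := exists_notin_P1 (e1 :: s) closedK.
rewrite in_cons negb_or => /andP[e21 e2s].
have [e3] := exists_notin_P1 (e2 :: e1 :: s) closedK.
rewrite !in_cons !negb_or => /and3P[e32 e31 e3s].
pose t := [:: e3; e2; e1].
have ts : {in t, forall e, e \notin s} by apply/allP; rewrite /= e3s e2s e1s.
(* Within distance [d] of [b] the map does not increase the distance to the orbit of [b], and the
   three points of [t] stay at least [d] away from [b]. *)
pose P b d := (forall z, chordal z b < d ->
    chordal (rateval f z) (rateval f b) <= chordal z b) /\
  {in t, forall e, d <= chordal e b}.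
have [||d d0 sd] := @common_radius R _ P s.
- move=> b d d' d'd [Pd td]; split=> [z zb|e te].
    by apply: Pd; apply: lt_le_trans d'd.
  exact: le_trans (td _ te).
- move=> b sb; have [d d0 Pd] := rateval_contract closedK deg_gt0 deg_f (s_ram b ^~ sb).
  have [||d' d'0 Pd'] := @common_radius R _ (fun e d => d <= chordal e b) t.
  + by move=> e d1 d2; apply: le_trans.
  + move=> e te; exists (chordal e b) => //; rewrite chordal_gt0.
    by apply: contraNneq (ts _ te) => ->.
  exists (Num.min d d'); first by rewrite lt_min d0.
  split=> [z|e /Pd'].
    by rewrite lt_min => /andP[/Pd].
  by apply: le_trans; rewrite ge_min lexx orbT.
have : ~ fatou_set f a by apply/sP.
apply; exists [set z | chordal a z < d]; split.
  by apply/nbhs_chordalP; exists d.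
apply: (@uniq_omits_three t) => //.
  by rewrite /= !in_cons !in_nil !orbF negb_or e32 e31 e21.
(* The union of the balls of radius [d] around [s] is mapped into itself. *)
have orb k z : chordal a z < d ->
    exists2 b, b \in s & chordal (iter k (rateval f) z) b < d.
  move=> az; elim: k => [|k [b sb kb]]; first by exists a; rewrite // chordalC.
  exists (rateval f b); first exact: s_fwd.
  by rewrite /= (le_lt_trans _ kb) //; apply: (sd _ sb).1.
move=> e te [k _ [z /= /(orb k)[b sb kb] def_e]].
by have := (sd _ sb).2 _ te; rewrite leNgt -def_e kb.
Qed.

End FatouSet.

(** * Comparison of the two kinds of components *)

Theorem proposition7p3 (p : nat) (p_prime : prime p)
    (R : realType) (Cp : ultrametricFieldType R) (hCp : is_Cp p Cp)
    (f : {fraction {poly Cp}}) (deg_f : (2 <= ratdeg f)%N)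
    (fatou_neq : fatou_set f <> [set: P1 Cp]) :
  forall x : P1 Cp, fatou_set f x ->
    fatou_component f x = analytic_component (fatou_set f) x.
Proof.
move=> x _.
have closedCp : GRing.closed_field_axiom Cp.
  by case: hCp => Qp [Qpbar [i [j [_ [closedQ _] _ /completion_closed]]]]; apply.
(* A component lies in the analytic component by forgetting the omission condition. Conversely, the
   orbit of an affinoid inside the Fatou set stays there, so it omits the infinite Julia set. *)
apply/seteqP; split=> y [X [X_aff XF Xx]] => [_|] Xy; exists X => //.
split=> //; apply: (@omits_three_sub _ _ _ (fatou_set f)).
  exact: forward_orbit_fatou.
have /infiniteP natJ := julia_infinite closedCp deg_f fatou_neq.
by apply: card_le_trans natJ; apply: card_leT.
Qed.
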